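(* Let $\epsilon>0$ be a constant. Let $d,k,t$ be integers with $d<2^{\epsilon k/5}$ and $t<\frac{\epsilon}{5}k^{d-1}$. Let $\{x^{(i,j)}\}_{i\in[t],j\in[d]}$ be independent and uniformly distributed in $\mathbb{F}_2^k$. Then $$\Pr\left[\sum_{i=1}^t\bigotimes_{j=1}^d x^{(i,j)}=0\right]\le 2^{-(1-\epsilon/2)kt}.$$
   Context: For vectors $u_1,\dots,u_d\in\mathbb{F}_2^k$, $\bigotimes_{j=1}^d u_j$ denotes the tensor $[k]^d\to\mathbb{F}_2$, $(i_1,\dots,i_d)\mapsto u_{1,i_1}\cdots u_{d,i_d}$ (an element of $(\mathbb{F}_2^k)^{\otimes d}\cong\mathbb{F}_2^{k^d}$); the sum is entrywise over $\mathbb{F}_2$. *)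

(* Defs.v *)
From HB Require Import structures.
From mathcomp Require Import all_boot all_order all_algebra.
From mathcomp Require Import all_classical all_reals all_analysis.

Set Implicit Arguments.
Unset Strict Implicit.
Unset Printing Implicit Defensive.

Import Order.TTheory GRing.Theory Num.Theory.

Local Open Scope classical_set_scope.
Local Open Scope ring_scope.

(* The tensor product of u_0, ..., u_(d-1) in F^k, a map [k]^d -> F. *)
Definition tensor (F : comNzRingType) (d k : nat) (u : 'I_d -> 'rV[F]_k) :
    {ffun {ffun 'I_d -> 'I_k} -> F} :=
  [ffun i : {ffun 'I_d -> 'I_k} => \prod_(j < d) u j ord0 (i j)].

(* The finite value space U carries the discrete sigma-algebra. *)
Definition finite_rv (disp : measure_display) (T : measurableType disp)
    (U : finType) (X : T -> U) : Prop :=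
  forall A : set U, measurable (X @^-1` A).

Definition uniform_rv (disp : measure_display) (T : measurableType disp)
    (R : realType) (P : probability T R) (U : finType) (X : T -> U) : Prop :=
  forall v : U, P (X @^-1` [set v]) = ((#|U|%:R)^-1)%:E.

(* Mutual independence, not merely pairwise. *)
Definition independent_rvs (disp : measure_display) (T : measurableType disp)
    (R : realType) (P : probability T R) (I U : finType)
    (X : I -> T -> U) : Prop :=
  forall (J : {set I}) (A : I -> set U),
    P (\bigcap_(i in [set` J]) (X i @^-1` A i)) =
    (\prod_(i in J) P (X i @^-1` A i))%E.

(* Main.v *)
Require Import Defs.
From HB Require Import structures.
From mathcomp Require Import all_boot all_order all_algebra all_field.
From mathcomp Require Import all_classical all_reals all_analysis.
From mathcomp Require Import ring lra zify.

(* Contracting the first factor x^(i,0), the sum of the tensors vanishes with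
   probability E[2^(-k rank(y_1, ..., y_t))], where y_i is the tensor product of
   the remaining D = d - 1 vectors. Revealing the y_i one at a time, each step
   either raises the rank or lands in a subspace V of dimension < t, so
   everything reduces to the probability that a random rank-one tensor with D
   factors lies in a given V; it is at most
     2^(-k) (D + 2^(k delta)),  where dim V = delta k^D.
   This goes by induction on D. Let V_u be the space of the w with u (x) w in V.
   If b_1, ..., b_k is a basis chosen greedily with dim V_(b_i) as large as
   possible, then dim V_u <= dim V_(b_i) for every u outside the span of
   b_1, ..., b_(i-1), and the sum of the dim V_(b_i) is at most dim V. Averaging
   over u then amounts to an inequality between real numbers,
     sum_i 2^(i-1) (y_i^k - 1) <= (2^k - 1) (y_1 ... y_k - 1)
   for 2 >= y_1 >= ... >= y_k >= 1. *)

Import Order.TTheory GRing.Theory Num.Theory.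

Local Open Scope classical_set_scope.
Local Open Scope ring_scope.

Set Implicit Arguments.
Unset Strict Implicit.
Unset Printing Implicit Defensive.

(** * A power inequality for nonincreasing real sequences *)

(** For [q <= K], [z ^+ K] is a convex function of [z ^+ q], so its chords from [l] have increasing
    slopes. The slopes are cross-multiplied, which covers equal points. *)
Lemma expr_chord (R : realDomainType) (l c h : R) (q K : nat) :
  0 <= l -> l <= c -> c <= h -> (q <= K)%N ->
  (c ^+ K - l ^+ K) * (h ^+ q - l ^+ q) <= (c ^+ q - l ^+ q) * (h ^+ K - l ^+ K).
Proof.
move=> l0 lc ch; have c0 := le_trans l0 lc; have h0 := le_trans c0 ch.
elim: K => [|K IH]; first by rewrite leqn0 => /eqP ->; rewrite !expr0 subrr.
rewrite leq_eqVlt => /orP[/eqP -> //|]; rewrite ltnS => qK.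
have splitS (z : R) : z ^+ K.+1 - l ^+ K.+1 = l * (z ^+ K - l ^+ K) + z ^+ K * (z - l).
  by rewrite !exprS; ring.
rewrite (splitS c) (splitS h) [leLHS]mulrDl [leRHS]mulrDr lerD //.
  by rewrite -mulrA [leRHS]mulrCA ler_wpM2l // IH.
rewrite (subrXX h l q) (subrXX c l q).
set Sh := \sum_(i < q) _; set Sc := \sum_(i < q) _.
(* This holds termwise: with [j = q - 1 - i <= K], both [c ^+ K * h ^+ j] and [h ^+ K * c ^+ j]
   contain the factor [(c * h) ^+ j]. *)
have le_S : c ^+ K * Sh <= h ^+ K * Sc.
  rewrite !mulr_sumr; apply: ler_sum => i _; rewrite !mulrA ler_wpM2r ?exprn_ge0 //.
  have -> : K = (q.-1 - i + (K - (q.-1 - i)))%N by rewrite subnKC //; lia.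
  rewrite !exprD mulrAC [leRHS]mulrAC [h ^+ _ * _]mulrC.
  by rewrite ler_wpM2l ?mulr_ge0 ?exprn_ge0 // lerXn2r.
suff : (c - l) * (h - l) * (c ^+ K * Sh) <= (c - l) * (h - l) * (h ^+ K * Sc).
  by congr (_ <= _); ring.
by rewrite ler_wpM2l // mulr_ge0 // subr_ge0 // (le_trans lc).
Qed.

(* With the first [q] values equal to [c], the difference of the two sides is
   concave as a function of [c ^+ q], so it is enough to treat the two ends of
   the range of [c]: at [c = h] the block factors out, and at [c = z] (the next
   value) it grows by one. *)
Lemma sum_expr_le_prod_block (R : realFieldType) (h : R) (K : nat) (y : seq R) (q : nat) (c : R) :
  1 <= h -> (0 < q)%N -> (q + size y <= K)%N -> c <= h -> path >=%R c y ->
  1 <= last c y ->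
  (h ^+ q - 1) * (c ^+ K - 1)
    + h ^+ q * ((h - 1) * \sum_(i < size y) h ^+ i * (y`_i ^+ K - 1))
  <= (h ^+ K - 1) * (c ^+ q * \prod_(z <- y) z - 1).
Proof.
move=> h1; elim: y q c => [|z y IH] q c q0 qK ch.
  move=> _ /= c1; rewrite big_ord0 big_nil !mulr0 addr0 mulr1.
  have := expr_chord ler01 c1 ch (q := q) (K := K).
  by rewrite !expr1n mulrC [leRHS]mulrC; apply; move: qK => /=; lia.
rewrite /= => /andP[zc pzy] z1.
have zge1 : 1 <= z.
  apply: le_trans z1 _; move: pzy; rewrite (path_sortedE (@ge_trans _ R)).
  case/andP=> /allP ally _; have := mem_last z y; rewrite inE => /orP[/eqP -> //|/ally //].
rewrite big_ord_recl big_cons expr0 mul1r /=.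
under eq_bigr do rewrite /bump /= add1n add0n exprS -mulrA.
rewrite -mulr_sumr; have zh := le_trans zc ch.
set S := \sum_(i < _) _; set Y := \prod_(i <- y) i.
have /= IH1 := IH 1%N z isT _ zh pzy z1.
have /= IHq := IH q.+1 z isT _ zh pzy z1.
move: IH1 IHq; rewrite -/S -/Y !expr1 /= => /(_ ltac:(move: qK => /=; lia)) IH1.
move=> /(_ ltac:(move: qK => /=; lia)) IHq.
have chord := expr_chord (le_trans ler01 zge1) zc ch (q := q) (K := K)
  ltac:(move: qK => /=; lia).
have hq1 : 1 <= h ^+ q by rewrite exprn_ege1.
have [hz|zlth] := eqVneq (h ^+ q) (z ^+ q).
  have hez : h = z.
    by apply/eqP; rewrite -(eqrXn2 q0 (le_trans ler01 h1) (le_trans ler01 zge1)) hz.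
  have hec : c = h by apply/eqP; rewrite eq_le ch hez zc.
  move: IHq; rewrite hec -hez; congr (_ <= _); rewrite !exprS; ring.
have zqh : z ^+ q <= h ^+ q by rewrite lerXn2r ?nnegrE // (le_trans ler01).
have d0 : 0 < h ^+ q - z ^+ q by rewrite subr_gt0 lt_neqAle eq_sym zlth.
have cqh : c ^+ q <= h ^+ q.
  by rewrite lerXn2r ?nnegrE ?(le_trans ler01) // (le_trans zge1).
have zqc : z ^+ q <= c ^+ q.
  by rewrite lerXn2r ?nnegrE ?(le_trans ler01) // (le_trans zge1).
(* After multiplication by [h ^+ q - z ^+ q], the goal is a nonnegative combination: [chord] with
   weight [h ^+ q - 1], [IHq] with weight [h ^+ q - c ^+ q], and [IH1] with weight
   [(c ^+ q - z ^+ q) * h ^+ q]. *)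
rewrite -subr_ge0 -(pmulr_rge0 _ d0).
move: IH1 IHq chord; rewrite -subr_ge0 => IH1; rewrite -subr_ge0 => IHq.
rewrite -subr_ge0 => chord.
have t0 : 0 <= (h ^+ q - 1) * _ := mulr_ge0 _ chord.
move: cqh zqc; rewrite -subr_ge0 => cqh; rewrite -subr_ge0 => zqc.
have t1 := mulr_ge0 cqh IHq.
have t2 := mulr_ge0 zqc (mulr_ge0 (le_trans ler01 hq1) IH1).
apply: le_trans (addr_ge0 (addr_ge0 (t0 _) t1) t2) _; first by rewrite subr_ge0.
rewrite le_eqVlt; apply/orP; left; apply/eqP; rewrite !exprS; ring.
Qed.

Lemma sum_expr_le_prod (R : realFieldType) (h : R) (K : nat) (y : seq R) :
  1 <= h -> (size y <= K)%N -> path >=%R h y -> 1 <= last h y ->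
  (h - 1) * \sum_(i < size y) h ^+ i * (y`_i ^+ K - 1)
    <= (h ^+ K - 1) * (\prod_(z <- y) z - 1).
Proof.
move=> h1; case: y => [|z y] /=; first by rewrite big_ord0 big_nil subrr !mulr0.
move=> yK /andP[zh pzy] z1.
have := sum_expr_le_prod_block h1 (isT : (0 < 1)%N) yK zh pzy z1.
rewrite big_ord_recl big_cons expr0 mul1r /= !expr1; congr (_ <= _).
under [in RHS]eq_bigr do rewrite /bump /= add1n add0n exprS -mulrA.
by rewrite -mulr_sumr; ring.
Qed.

(** * Greedy bases and sums over all vectors *)

(* [y] lists the values of [D] on vectors completing [B] to a basis, each chosen
   to maximize [D] outside the span of the previous ones. *)
Lemma greedy_basis_sum (R : realDomainType) (F : finFieldType) (k : nat)
    (D : 'rV[F]_k -> nat) (N n c : nat) (B : seq 'rV[F]_k) :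
  (forall B', free B' -> (\sum_(u <- B') D u <= N)%N) ->
  free B -> (size B + n = k)%N -> (forall u, u \notin <<B>>%VS -> (D u <= c)%N) ->
  exists y : seq nat,
    [/\ size y = n, path geq c y, (\sum_(u <- B) D u + \sum_(m <- y) m <= N)%N &
     forall g : nat -> R, {homo g : a b / (a <= b)%N >-> a <= b} ->
     \sum_(u | u \notin <<B>>%VS) g (D u)
       <= \sum_(i < n) #|F|%:R ^+ (size B + i) * (#|F|%:R - 1) * g y`_i].
Proof.
move=> DN; have dimk : \dim {: 'rV[F]_k} = k by rewrite dimvf; exact: mul1n.
elim: n c B => [|n IH] c B freeB szB Dc.
  exists [::]; split => //; first by rewrite big_nil addn0 DN.
  move=> g _; rewrite big_ord0 big_pred0 // => u; apply/negbTE; rewrite negbK.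
  suff -> : <<B>>%VS = fullv by rewrite memvf.
  apply/eqP; rewrite eqEdim subvf dimk.
  by move: freeB; rewrite /free => /eqP -> /=; lia.
have dimB : \dim <<B>> = size B by move: freeB; rewrite /free => /eqP.
have [u0 u0B] : exists u0, u0 \notin <<B>>%VS.
  apply/existsP; apply: contraT; rewrite negb_exists => /forallP allB.
  have : (fullv <= <<B>>)%VS by apply/subvP => v _; have := allB v; rewrite negbK.
  by move/dimvS; rewrite dimk dimB; lia.
pose b := [arg max_(u > u0 | u \notin <<B>>%VS) D u].
have [bB bmax] : b \notin <<B>>%VS /\ forall u, u \notin <<B>>%VS -> (D u <= D b)%N.
  by rewrite /b; case: arg_maxnP.
have freebB : free (b :: B) by rewrite free_cons bB.
have sub_bB : {subset <<B>>%VS <= <<b :: B>>%VS}.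
  by apply/subvP/sub_span => v vB; rewrite inE vB orbT.
have [|u /(contra (@sub_bB u)) /bmax //|y [sy py Ny Hy]] := IH (D b) (b :: B) freebB.
  by rewrite /=; lia.
exists (D b :: y); split; rewrite /= ?sy //.
- by rewrite py andbT Dc.
- by move: Ny; rewrite !big_cons; lia.
move=> g g_homo; rewrite big_ord_recl /= addn0 (bigID (mem <<b :: B>>%VS)) /=.
apply: lerD.
  (* The coefficient of [g (D b)] is the number of vectors in the span of [b :: B] but outside that
     of [B]. *)
  have -> : #|F|%:R ^+ size B * (#|F|%:R - 1) * g (D b) =
      \sum_(u | (u \notin <<B>>%VS) && (u \in <<b :: B>>%VS)) g (D b).
    rewrite sumr_const -[RHS]mulr_natl; congr (_ * _).
    have cardV (X : seq 'rV[F]_k) : free X -> #|<<X>>%VS| = (#|F| ^ size X)%N.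
      by move=> /eqP <-; rewrite card_vspace.
    have := cardID (mem <<B>>%VS) (mem <<b :: B>>%VS); rewrite (cardV _ freebB) /=.
    rewrite [X in (X + _)%N](_ : _ = #|<<B>>%VS|); last first.
      by apply: eq_card => u; rewrite !inE andb_idl //; exact: sub_bB.
    rewrite (cardV _ freeB) => /(congr1 (fun m => m%:R : R)).
    rewrite natrD !natrX exprS => e.
    have -> : #|[pred u | (u \notin <<B>>%VS) && (u \in <<b :: B>>%VS)]|%:R =
      #|F|%:R * #|F|%:R ^+ size B - #|F|%:R ^+ size B :> R.
      by rewrite -e addrAC subrr add0r; congr (_%:R); apply: eq_card => u; rewrite !inE.
    ring.
  by apply: ler_sum => u /andP[uB _]; apply/g_homo/bmax.
rewrite (eq_bigl (fun u => u \notin <<b :: B>>%VS)); last first.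
  by move=> u; rewrite andb_idl // => /(contra (@sub_bB u)); apply.
apply: le_trans (Hy g g_homo) _; apply: ler_sum => i _.
by rewrite /= /bump /= add1n addSn addnS.
Qed.

(** The greedy list [y] reduces this to [sum_expr_le_prod] with [h = #|F|] and entries [x ^+ y_i],
    whose product is [x] to the power of the sum of [y], a sum bounded by [N]. *)
Lemma independent_profile_sum (R : realFieldType) (F : finFieldType) (k N : nat)
    (D : 'rV[F]_k -> nat) (x : R) :
  1 <= x -> (forall B, free B -> (\sum_(u <- B) D u <= N)%N) ->
  (forall u, u != 0 -> x ^+ D u <= #|F|%:R) ->
  \sum_(u | u != 0) (x ^+ (D u * k) - 1) <= (#|F|%:R ^+ k - 1) * (x ^+ N - 1).
Proof.
move=> x1 DN xD.
have xX a b : (a <= b)%N -> x ^+ a <= x ^+ b by move=> ab; rewrite ler_weXn2l.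
have h1 : 1 <= #|F|%:R :> R by rewrite ler1n ltnW // finNzRing_gt1.
pose c := (\max_(u : 'rV[F]_k | u != 0%R) D u)%N.
have xc : x ^+ c <= #|F|%:R.
  by rewrite /c; elim/big_ind: _ => // a b ha hb; case: (leqP a b) => _.
have [u|y [sy py Ny /(_ (fun a => x ^+ (a * k) - 1)) Hy]] :=
  greedy_basis_sum R (c := c) DN (nil_free _) (erefl (0 + k)%N).
  by rewrite span_nil memv0 => u0; rewrite /c; apply: leq_bigmax_cond.
under eq_bigl => u do rewrite -memv0 -span_nil.
apply: le_trans (Hy _) _ => [a b ab|].
  by rewrite lerD2r xX // leq_mul2r ab orbT.
rewrite big_nil add0n in Ny.
have -> : \sum_(i < k) #|F|%:R ^+ (size (nil : seq 'rV[F]_k) + i) * (#|F|%:R - 1) *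
      (x ^+ ((y`_i)%R * k) - 1) = (#|F|%:R - 1) *
     \sum_(i < size [seq x ^+ a | a <- y]) #|F|%:R ^+ i * ([seq x ^+ a | a <- y]`_i ^+ k - 1).
  rewrite size_map sy mulr_sumr; apply: eq_bigr => i _.
  by rewrite (nth_map 0%N) ?sy // -exprM mulrAC mulrA [RHS]mulrAC mulrC mulrA mulrAC.
have pxy : path >=%R #|F|%:R [seq x ^+ a | a <- y].
  case: (y) py => //= a z /andP[ac paz]; rewrite (le_trans (xX _ _ ac)) //=.
  by rewrite path_map; apply: sub_path paz => i j; exact: xX.
apply: le_trans (sum_expr_le_prod h1 _ pxy _) _; first by rewrite size_map sy.
  by case: (y) => //= a z; rewrite last_map exprn_ege1.
rewrite ler_wpM2l ?subr_ge0 ?exprn_ege1 // lerD2r big_map.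
by rewrite prodrXr xX.
Qed.

(** * Cardinals as sums, and finite functions split at their first value *)

Lemma natr_card_pred (R : pzSemiRingType) (X : finType) (p : pred X) :
  #|[pred x | p x]|%:R = \sum_x (p x)%:R :> R.
Proof. by rewrite -sum1_card natr_sum big_mkcond; apply: eq_bigr => x _; rewrite /= mulrb. Qed.

Definition fcons (n : nat) (X : Type) (x : X) (f : {ffun 'I_n -> X}) :
    {ffun 'I_n.+1 -> X} :=
  [ffun i => oapp f x (unlift ord0 i)].

Lemma fcons0 (n : nat) (X : Type) (x : X) (f : {ffun 'I_n -> X}) :
  fcons x f ord0 = x.
Proof. by rewrite ffunE unlift_none. Qed.

Lemma fconsS (n : nat) (X : Type) (x : X) (f : {ffun 'I_n -> X}) j :
  fcons x f (lift ord0 j) = f j.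
Proof. by rewrite ffunE liftK. Qed.

Lemma sum_fcons (A : nmodType) (X : finType) (n : nat)
    (G : {ffun 'I_n.+1 -> X} -> A) :
  \sum_f G f = \sum_x \sum_(g : {ffun 'I_n -> X}) G (fcons x g).
Proof.
rewrite pair_big /= (reindex (fun p : X * {ffun 'I_n -> X} => fcons p.1 p.2)) //.
exists (fun f : {ffun 'I_n.+1 -> X} => (f ord0, [ffun j : 'I_n => f (lift ord0 j)])) => [[x g]|f] _ /=.
  by congr pair; rewrite ?fcons0 //; apply/ffunP => j; rewrite ffunE fconsS.
apply/ffunP => i; case: (unliftP ord0 i) => [j ->|->]; last by rewrite fcons0.
by rewrite fconsS ffunE.
Qed.

(** * Rank-one tensors in a subspace *)

Section RankOneTensors.

Context (F : finFieldType) (k : nat).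

(* [F^o] only serves to make the space of tensors a vector space over [F]. *)
Notation tensors d := {ffun {ffun 'I_d -> 'I_k} -> F^o}.

Definition vtensor (d : nat) (us : {ffun 'I_d -> 'rV[F]_k}) : tensors d := tensor us.

Definition outer (d : nat) (u : 'rV[F]_k) (w : tensors d) : tensors d.+1 :=
  [ffun i : {ffun 'I_d.+1 -> 'I_k} =>
    u ord0 (i ord0) * w [ffun j : 'I_d => i (lift ord0 j)]].

Fact outer_is_linear d u : linear (@outer d u).
Proof.
by move=> a w w'; apply/ffunP => i; rewrite !ffunE /GRing.scale /= mulrDr mulrCA.
Qed.

HB.instance Definition _ d u :=
  GRing.isLinear.Build F (tensors d) (tensors d.+1) _ (@outer d u) (@outer_is_linear d u).

Lemma outer_fcons d u (w : tensors d) a i : outer u w (fcons a i) = u ord0 a * w i.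
Proof.
rewrite ffunE fcons0; congr (_ * w _).
by apply/ffunP => j; rewrite ffunE fconsS.
Qed.

Lemma vtensor_fcons d u (us : {ffun 'I_d -> 'rV[F]_k}) :
  vtensor (fcons u us) = outer u (vtensor us).
Proof.
apply/ffunP => i; rewrite !ffunE big_ord_recl fcons0; congr (_ * _).
by apply: eq_bigr => j _; rewrite fconsS ffunE.
Qed.

(** This is the space [V_u] of the overview. *)
Definition slicev d (V : {vspace tensors d.+1}) (u : 'rV[F]_k) : {vspace tensors d} :=
  (linfun (outer u) @^-1: V)%VS.

Lemma slicevE d (V : {vspace tensors d.+1}) u w :
  (w \in slicev V u) = (outer u w \in V).
Proof. by rewrite -memv_preim lfunE. Qed.

(** The images of the slices under [outer u] lie in [V] and have the same dimensions as the slices.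
    Their sum is direct: evaluated at a tail index [s], a vanishing sum becomes a linear relation
    between the vectors of [B]. *)
Lemma dim_slicev_free d (V : {vspace tensors d.+1}) (B : seq 'rV[F]_k) :
  free B -> (\sum_(u <- B) \dim (slicev V u) <= \dim V)%N.
Proof.
move=> freeB; pose O u := (linfun (outer u) @: slicev V u)%VS.
have dimO u : u != 0 -> \dim (O u) = \dim (slicev V u).
  move=> /rV0Pn[a ua]; apply: limg_dim_eq; apply/eqP; rewrite -subv0; apply/subvP => w.
  rewrite memv_cap memv0 memv_ker lfunE /= => /andP[_ /eqP w0].
  apply/eqP/ffunP => i; have := congr1 (fun f : tensors d.+1 => f (fcons a i)) w0.
  by rewrite outer_fcons !ffunE => /eqP; rewrite mulf_eq0 (negbTE ua) => /eqP.
rewrite (eq_big_seq (fun u => \dim (O u))) => [|u uB]; last first.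
  by rewrite dimO // (free_not0 freeB).
rewrite big_tnth.
have /directvP/= <- : directv (\sum_(i < size B) O (tnth (in_tuple B) i)).
  apply/directv_sum_independent => us usO us0.
  have /fin_all_exists[ws Hws] i : exists w, us i = outer (tnth (in_tuple B) i) w.
    by have /memv_imgP[w _ ->] := usO i isT; exists w; rewrite lfunE.
  move=> i _; rewrite Hws.
  suff -> : ws i = 0 by rewrite linear0.
  apply/ffunP => s; rewrite ffunE.
  have /freeP indep : free (in_tuple B) := freeB.
  apply: (indep (fun j => ws j s : F)); apply/rowP => a.
  have := congr1 (fun f : tensors d.+1 => f (fcons a s)) us0.
  rewrite sum_ffunE !ffunE summxE mxE => us_as; rewrite -[RHS]us_as.
  by apply: eq_bigr => j _; rewrite Hws outer_fcons !mxE mulrC (tnth_nth 0).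
apply: dimvS; apply/subv_sumP => i _; apply/subvP => w /memv_imgP[v].
by rewrite slicevE => vV ->; rewrite lfunE.
Qed.

(** Fixing the first vector [u] leaves a tensor in [slicev V u], to which the induction hypothesis
    applies; [independent_profile_sum] handles the sum over nonzero [u]. *)
Lemma card_vtensor_in (R : realType) (d : nat) (V : {vspace tensors d}) :
  (0 < k)%N ->
  #|F|%:R ^+ k * #|[pred us : {ffun 'I_d -> 'rV[F]_k} | vtensor us \in V]|%:R
    <= #|F|%:R ^+ (k * d)
       * (d%:R + #|F|%:R `^ (k%:R / k%:R ^+ d * (\dim V)%:R)) :> R.
Proof.
move=> k0; have kR0 : 0 < k%:R :> R by rewrite ltr0n.
have h1 : 1 <= #|F|%:R :> R by rewrite ler1n ltnW // finNzRing_gt1.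
have h0 := le_trans ler01 h1.
elim: d V => [|d IH] V.
  rewrite muln0 expr0 mul1r add0r divr1.
  (* The empty tensor product is the constant 1, so it can only lie in a nonzero [V]. *)
  case: (pickP [pred us : {ffun 'I_0 -> 'rV[F]_k} | vtensor us \in V]) => [us usV|no].
    have dimV : (0 < \dim V)%N.
      rewrite lt0n dimv_eq0; apply: contraTneq (usV : vtensor us \in V) => ->; rewrite memv0.
      apply/eqP => /ffunP/(_ [ffun i : 'I_0 => Ordinal k0]); rewrite !ffunE big_ord0.
      by apply/eqP; rewrite oner_eq0.
    apply: (@le_trans _ _ (#|F|%:R ^+ k * 1)).
      rewrite ler_wpM2l ?exprn_ge0 // lern1 (leq_trans (max_card _)) //.
      by rewrite card_ffun card_ord expn0.
    by rewrite mulr1 -powR_mulrn // ler_powR // ler_peMr ?ler0n // ler1n.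
  by rewrite (eq_card0 no) mulr0 powR_ge0.
rewrite [X in _ * X <= _]natr_card_pred sum_fcons mulr_sumr.
(* With this base, [x ^+ \dim V] is the exponential in the goal, and [x ^+ (n * k)] is the one in
   the induction hypothesis for a slice of dimension [n]. *)
pose x : R := #|F|%:R `^ (k%:R / k%:R ^+ d.+1).
have xE n : x ^+ n = #|F|%:R `^ (k%:R / k%:R ^+ d.+1 * n%:R).
  by rewrite -powR_mulrn ?powR_ge0 // -powRrM.
have kd0 : k%:R ^+ d != 0 :> R by rewrite expf_neq0 // gt_eqF.
have x1 : 1 <= x.
  by rewrite -[leLHS](powRr0 (#|F|%:R)) ler_powR // divr_ge0 ?exprn_ge0 ?ler0n.
have D0 u : u != 0 -> x ^+ \dim (slicev V u) <= #|F|%:R.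
  move=> _; rewrite xE -[leRHS]powRr1 // ler_powR //.
  have /(leq_trans (dimvS (subvf _))) le_kd : (\dim {: tensors d} <= k ^ d)%N.
    by rewrite dimvf /dim /= muln1 card_ffun !card_ord.
  rewrite exprS invfM mulrA divff ?mul1r ?gt_eqF //.
  rewrite mulrC ler_pdivrMr ?exprn_gt0 // mul1r -natrX ler_nat; exact: le_kd.
have := independent_profile_sum x1 (@dim_slicev_free _ V) D0.
rewrite big_split /= sumrN sumr_const => prof.
have cardu : #|[pred u : 'rV[F]_k | u != 0]|%:R = #|F|%:R ^+ k - 1 :> R.
  rewrite (eq_card (_ : _ =i predC1 (0 : 'rV[F]_k))) // cardC1 card_mx mul1n.
  by rewrite -subn1 natrB ?natrX // expn_gt0 ltnW // finNzRing_gt1.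
rewrite (bigD1 (0 : 'rV[F]_k)) //=.
have le_slice u : u != 0 ->
    #|F|%:R ^+ k * \sum_(us : {ffun 'I_d -> 'rV[F]_k}) (vtensor (fcons u us) \in V)%:R
    <= #|F|%:R ^+ (k * d) * (d%:R + x ^+ (\dim (slicev V u) * k)).
  move=> _; have IHu := IH (slicev V u).
  rewrite [X in _ * X <= _]natr_card_pred in IHu; move: IHu.
  congr (_ * _ <= _ * (_ + _)).
    by apply: eq_bigr => us _; rewrite slicevE vtensor_fcons.
  rewrite xE natrM exprS; congr (_ `^ _); field.
  by rewrite kd0 gt_eqF.
(* For [u = 0] the trivial bound suffices: its cost is absorbed by the passage from [d] to
   [d.+1]. *)
have le_slice0 :
    #|F|%:R ^+ k * \sum_(us : {ffun 'I_d -> 'rV[F]_k}) (vtensor (fcons 0 us) \in V)%:R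
    <= #|F|%:R ^+ (k * d) * #|F|%:R ^+ k :> R.
  rewrite mulrC ler_wpM2r ?exprn_ge0 //.
  apply: (@le_trans _ _ (\sum_(us : {ffun 'I_d -> 'rV[F]_k}) 1)).
    by apply: ler_sum => us _; rewrite lern1 leq_b1.
  by rewrite sumr_const card_ffun card_mx card_ord mul1n -expnM natrX.
apply: le_trans (lerD le_slice0 (ler_sum _ le_slice)) _.
rewrite -mulr_sumr -mulrDr mulnS addnC exprD -mulrA ler_wpM2l ?exprn_ge0 //.
rewrite big_split /= sumr_const -[d%:R *+ _]mulr_natl.
rewrite -xE; move: prof; rewrite -[(1 *+ _)]/(_%:R) cardu => prof.
have xN : 0 <= x ^+ \dim V by rewrite exprn_ge0 // (le_trans ler01).
have := ler0n R d; rewrite -natr1; move: xN prof.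
move: (\sum_(i | _) _) (x ^+ _) (_ ^+ k) (d%:R) => S X A e.
by lra.
Qed.

End RankOneTensors.

(** * Counting vanishing sums of tensors *)

(* If [phi y] is not in [V], at most one [u] makes the combination fall in [V],
   and the remaining terms then combine into [V + <[phi y]>]. *)
Lemma count_vanishing_combinations (R : realDomainType) (F : finFieldType) (k : nat)
    (W : vectType F) (Y : finType) (phi : Y -> W) (q : R) (m : nat) :
  (forall V : {vspace W}, (\dim V < m)%N ->
     #|F|%:R ^+ k * #|[pred y | phi y \in V]|%:R + #|Y|%:R <= q) ->
  forall (s : nat) (V : {vspace W}), (\dim V + s <= m)%N ->
  \sum_(f : {ffun 'I_s -> 'rV[F]_k * Y})
     [forall a, \sum_(i < s) (f i).1 ord0 a *: phi (f i).2 \in V]%:R <= q ^+ s.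
Proof.
move=> Hq; elim => [|s IH] V.
  move=> _; rewrite expr0; apply: (@le_trans _ _ (\sum_(f : {ffun 'I_0 -> 'rV[F]_k * Y}) 1)).
    by apply: ler_sum => f _; rewrite lern1 leq_b1.
  by rewrite sumr_const card_ffun card_ord expn0.
rewrite addnS => Vm; have q0 : 0 <= q.
  by apply: le_trans (Hq 0%VS _); rewrite ?dimv0 ?addr_ge0 ?mulr_ge0 ?exprn_ge0 ?ler0n //; lia.
have sum_pair (G : 'rV[F]_k * Y -> R) : \sum_p G p = \sum_y \sum_u G (u, y).
  by rewrite exchange_big pair_bigA; apply: eq_bigr => -[].
rewrite sum_fcons sum_pair.
have sumE u y (g : {ffun 'I_s -> 'rV[F]_k * Y}) a :
    \sum_(i < s.+1) (fcons (u, y) g i).1 ord0 a *: phi (fcons (u, y) g i).2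
    = u ord0 a *: phi y + \sum_(i < s) (g i).1 ord0 a *: phi (g i).2.
  by rewrite big_ord_recl fcons0; congr (_ + _); apply: eq_bigr => i _; rewrite fconsS.
(* When [phi y] is in [V], all [#|F| ^ k] vectors [u] are allowed and [V] is kept; otherwise the
   summand 1 pays for the single possible [u]. *)
apply: (@le_trans _ _ (\sum_y (#|F|%:R ^+ k * (phi y \in V)%:R + 1) * q ^+ s)); last first.
  rewrite -mulr_suml exprS ler_wpM2r ?exprn_ge0 //.
  apply: le_trans (Hq V _); last by lia.
  by rewrite big_split /= -mulr_sumr sumr_const natr_card_pred.
apply: ler_sum => y _; have [yV|yV] := boolP (phi y \in V).
  rewrite mulr1 mulrDl mul1r -[leLHS]addr0 lerD ?exprn_ge0 //.
  apply: (@le_trans _ _ (\sum_(u : 'rV[F]_k) q ^+ s)); last first.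
    by rewrite sumr_const card_mx mul1n -[leLHS]mulr_natl natrX.
  apply: ler_sum => u _; apply: le_trans (IH V _); last by lia.
  apply: ler_sum => g _; rewrite ler_nat; case: forallP => //= all_in.
  suff -> : [forall a, \sum_(i < s) (g i).1 ord0 a *: phi (g i).2 \in V] by [].
  by apply/forallP => a; have := all_in a; rewrite sumE rpredDl // rpredZ.
rewrite mulr0 add0r mul1r exchange_big /=.
apply: le_trans (IH (V + <[phi y]>)%VS _); last first.
  have [le_dim _] := dimv_add_leqif V <[phi y]>; move: le_dim; rewrite dim_vline.
  by move: (leq_b1 (phi y != 0)); lia.
apply: ler_sum => g _.
case: (pickP (fun u => [forall a, \sum_(i < s.+1) (fcons (u, y) g i).1 ord0 a *:
   phi (fcons (u, y) g i).2 \in V])) => [u /forallP uV|no]; last first.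
  by rewrite big1 ?ler0n // => u _; rewrite no.
rewrite (bigD1 u) //= big1 => [|v vu]; last first.
  apply/eqP; rewrite pnatr_eq0 eqb0; apply: contra vu => /forallP vV.
  apply/eqP/rowP => a; have := rpredB (vV a) (uV a).
  rewrite !sumE opprD addrACA subrr addr0 -scalerBl => uvV.
  apply/eqP; rewrite -subr_eq0; apply: contraR yV => uv0.
  by rewrite -[phi y](scalerK uv0) rpredZ.
rewrite addr0 ler_nat; apply: leq_trans (leq_b1 _) _.
rewrite lt0b; apply/forallP => a; have := uV a; rewrite sumE => sV.
rewrite -[X in X \in _](addKr (u ord0 a *: phi y)) addrC memv_add //.
by rewrite rpredN rpredZ // memv_line.
Qed.

(** Each coordinate [a] of the first factor gives a vanishing combination of the tensors of the
    other [D] vectors, so [count_vanishing_combinations] applies with the zero subspace. *)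
Lemma card_tensor_sum_eq0 (R : realType) (F : finFieldType) (k D t : nat) :
  (0 < k)%N ->
  #|[pred c : {ffun 'I_t * 'I_D.+1 -> 'rV[F]_k} |
      \sum_(i < t) tensor (fun j => c (i, j)) == 0]|%:R
  <= (#|F|%:R ^+ (k * D)
      * (D.+1%:R + #|F|%:R `^ (k%:R / k%:R ^+ D * t%:R))) ^+ t :> R.
Proof.
move=> k0; have h1 : 1 <= #|F|%:R :> R by rewrite ler1n ltnW // finNzRing_gt1.
set q := _ * _.
(* The term [D.+1] in [q] is the [D] of [card_vtensor_in] plus 1 for the count of all tuples. *)
have Hq (V : {vspace {ffun {ffun 'I_D -> 'I_k} -> F^o}}) : (\dim V < t)%N ->
    #|F|%:R ^+ k * #|[pred us : {ffun 'I_D -> 'rV[F]_k} | vtensor us \in V]|%:R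
      + #|{ffun 'I_D -> 'rV[F]_k}|%:R <= q.
  move=> Vt; apply: le_trans (lerD (card_vtensor_in R V k0) (lexx _)) _.
  rewrite card_ffun card_mx card_ord mul1n -expnM natrX /q -[X in _ + X]mulr1 -mulrDr.
  rewrite ler_wpM2l ?exprn_ge0 ?ler0n // -natr1 -!addrA lerD2l addrC lerD2l.
  by rewrite ler_powR // ler_wpM2l ?divr_ge0 ?exprn_ge0 ?ler0n // ler_nat ltnW.
have := count_vanishing_combinations Hq (V := 0%VS) (s := t).
rewrite dimv0 add0n => /(_ (leqnn _)); apply: le_trans.
rewrite [leLHS]natr_card_pred.
pose split (c : {ffun 'I_t * 'I_D.+1 -> 'rV[F]_k}) :=
  [ffun i : 'I_t => (c (i, ord0), [ffun j : 'I_D => c (i, lift ord0 j)])].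
rewrite [leRHS](reindex split) /=; last first.
  exists (fun f => [ffun ij => fcons (f ij.1).1 (f ij.1).2 ij.2]) => [c|f] _.
    apply/ffunP => -[i j]; rewrite !ffunE /=.
    by case: (unliftP ord0 j) => [j' ->|->] //=; rewrite ffunE.
  apply/ffunP => i; rewrite [LHS]ffunE [RHS]surjective_pairing; congr pair.
    by rewrite ffunE fcons0.
  by apply/ffunP => j; rewrite 2!ffunE fconsS.
apply: ler_sum => c _; rewrite ler_nat; case: eqP => // c0.
rewrite lt0b; apply/forallP => a; rewrite memv0; apply/eqP/ffunP => s.
have := congr1 (fun T : {ffun _ -> F} => T (fcons a s)) c0.
rewrite /= !sum_ffunE !ffunE => c0s; rewrite -[RHS]c0s; apply: eq_bigr => i _.
rewrite !ffunE /= big_ord_recl fcons0; congr (_ * _).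
by apply: eq_bigr => j _; rewrite fconsS ffunE.
Qed.

(** * From counting to probability *)

(** The event is a finite disjoint union of cylinders fixing every [X i]; independence over the
    whole index set gives them all the same probability. *)
Lemma probability_uniform_pred (disp : measure_display) (T : measurableType disp)
    (R : realType) (P : probability T R) (I U : finType) (X : I -> T -> U)
    (p : pred {ffun I -> U}) :
  (forall i, finite_rv (X i)) -> (forall i, uniform_rv P (X i)) ->
  independent_rvs P X ->
  P [set w | p [ffun i => X i w]] = (#|p|%:R / #|U|%:R ^+ #|I|)%:E.
Proof.
move=> mX uX iX.
pose cyl (c : {ffun I -> U}) := \bigcap_(i in [set` [set: I]%SET]) (X i @^-1` [set c i]).
have -> : [set w | p [ffun i => X i w]] = \bigcup_(c in [set` enum p]) cyl c.
  apply/seteqP; split => w /=.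
    move=> pw; exists [ffun i => X i w]; first by rewrite /= mem_enum.
    by move=> i _ /=; rewrite ffunE.
  case=> c; rewrite /= mem_enum => pc cw.
  suff -> : [ffun i => X i w] = c by [].
  by apply/ffunP => i; rewrite ffunE; apply: (cw i); rewrite /= inE.
have Pcyl c : P (cyl c) = ((#|U|%:R ^+ #|I|)^-1)%:E.
  rewrite iX (eq_bigr (fun=> ((#|U|%:R)^-1)%:E)) => [|i _]; last exact: uX.
  by rewrite -(big_morph EFin (@EFinM R) (erefl _)) prodr_const cardsT exprVn.
rewrite measure_fin_bigcup //.
- rewrite -fsbig_seq ?enum_uniq // (eq_bigr (fun=> ((#|U|%:R ^+ #|I|)^-1)%:E)).
    by rewrite sumEFin big_enum sumr_const; congr EFin; rewrite -[LHS]mulr_natl.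
  by move=> c _; exact: Pcyl.
- move=> c c' _ _ [w [cw c'w]]; apply/ffunP => i.
  have <- : X i w = c i by apply: (cw i); rewrite /= inE.
  by apply: (c'w i); rewrite /= inE.
move=> c _; apply: fin_bigcap_measurable => // i _; exact: mX.
Qed.

Unset Implicit Arguments.

Theorem theorem3p4 (R : realType) (eps : R) (d k t : nat)
    (disp : measure_display) (T : measurableType disp) (P : probability T R)
    (x : 'I_t * 'I_d -> T -> 'rV['F_2]_k) :
  0 < eps ->
  d%:R < 2 `^ (eps * k%:R / 5) ->
  t%:R < eps / 5 * k%:R ^ (d%:Z - 1) ->
  (forall ij, finite_rv (x ij)) ->
  (forall ij, uniform_rv P (x ij)) ->
  independent_rvs P x ->
  (P [set w | (\sum_(i < t) tensor (fun j : 'I_d => x (i, j) w) = 0)%R]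
     <= (2 `^ (- ((1 - eps / 2) * k%:R * t%:R)))%:E)%E.
Proof.
move=> eps0 d_lt t_lt mx ux ix.
pose zero_sum := [pred c : {ffun 'I_t * 'I_d -> 'rV['F_2]_k} |
  \sum_(i < t) tensor (fun j => c (i, j)) == 0].
have sumE w : \sum_(i < t) tensor (fun j : 'I_d => [ffun ij => x ij w] (i, j))
    = \sum_(i < t) tensor (fun j => x (i, j) w).
  apply: eq_bigr => i _; congr tensor.
  by apply/funext => j; rewrite ffunE.
have -> : [set w | \sum_(i < t) tensor (fun j : 'I_d => x (i, j) w) = 0] =
    [set w | zero_sum [ffun ij => x ij w]].
  by apply/seteqP; split => w /=; rewrite sumE => /eqP.
rewrite (probability_uniform_pred _ mx ux ix) lee_fin.
rewrite card_mx mul1n card_Fp // card_prod !card_ord natrX.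
have two_gt0 n : 0 < 2%:R ^+ n :> R by rewrite exprn_gt0.
(* In these cases the claimed bound is at least 1. *)
have [triv|] := boolP ((t == 0%N) || (2 <= eps)).
  apply: (@le_trans _ _ 1).
    rewrite ler_pdivrMr ?exprn_gt0 // mul1r -!natrX ler_nat.
    by rewrite (leq_trans (max_card _)) // card_ffun card_mx mul1n card_Fp // card_prod !card_ord.
  rewrite -[leLHS](powRr0 2) ler_powR ?ler1n // oppr_ge0.
  case/orP: triv => [/eqP ->|eps2]; first by rewrite mulr0.
  by rewrite -mulrA mulr_le0_ge0 ?mulr_ge0 ?ler0n // subr_le0 ler_pdivlMr ?mul1r.
rewrite negb_or -lt0n -ltNge => /andP[t0 eps2].
have t1 : 1 <= t%:R :> R by rewrite ler1n.
(* If [k = 0] then [d = 0], and [0 ^ (-1)] is 0 by convention, so [t_lt] would give [t < 0]. *)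
have k0 : (0 < k)%N.
  rewrite lt0n; apply: contraTneq t_lt => k0; rewrite -leNgt k0.
  move: d_lt; rewrite k0 mulr0 mul0r powRr0 ltrn1 ltnS leqn0 => /eqP ->.
  by rewrite sub0r exprN1 invr0 mulr0.
have k1 : 1 <= k%:R :> R by rewrite ler1n.
(* For [d <= 1] the power of [k] is at most 1, so [t < eps / 5 < 1]. *)
have d2 : (1 < d)%N.
  rewrite ltnNge; apply/negP => d1; move: t_lt; apply/negP; rewrite -leNgt.
  apply: (@le_trans _ _ (eps / 5 * 1)); last by move: t1 eps2; lra.
  rewrite ler_wpM2l ?divr_ge0 ?(ltW eps0) //; case: (d) d1 => [|[|//]] _.
    by rewrite sub0r exprN1 invf_le1 // (lt_le_trans ltr01).
  by rewrite subrr expr0z.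
case: d d2 => [//|[//|D]] _ in x d_lt t_lt mx ux ix @zero_sum sumE *.
have kD0 : 0 < k%:R ^+ D.+1 :> R by rewrite exprn_gt0 // (lt_le_trans ltr01).
have tD : k%:R / k%:R ^+ D.+1 * t%:R <= eps * k%:R / 5.
  move: t_lt; have -> : D.+2%:Z - 1 = D.+1%:Z by rewrite -addn1 PoszD addrK.
  rewrite -exprnP => /ltW t_le; rewrite mulrAC ler_pdivrMr //.
  have -> : eps * k%:R / 5 * k%:R ^+ D.+1 = k%:R * (eps / 5 * k%:R ^+ D.+1) by ring.
  by rewrite ler_wpM2l.
set e := eps * k%:R / 5 in d_lt tD.
have e1 : 1 <= e.
  rewrite leNgt; apply/negP => e_lt1; move: d_lt; apply/negP; rewrite -leNgt.
  apply: (@le_trans _ _ (2 `^ 1)); first by rewrite ler_powR ?ler1n // ltW.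
  by rewrite powRr1 // ler_nat.
have := card_tensor_sum_eq0 R 'F_2 D.+1 t k0; rewrite card_Fp // => card_le.
rewrite ler_pdivrMr ?exprn_gt0 //; apply: le_trans card_le _.
have -> : 2 `^ (- ((1 - eps / 2) * k%:R * t%:R)) = (2 `^ (- ((1 - eps / 2) * k%:R))) ^+ t.
  by rewrite -mulNr powRrM powR_mulrn ?powR_ge0.
rewrite [(t * _)%N]mulnC [_ ^+ (_ * t)]exprM -exprMn.
apply: lerXn2r; rewrite ?nnegrE.
- by apply: mulr_ge0; rewrite ?exprn_ge0 // (addr_ge0 (ler0n _ _) (powR_ge0 _ _)).
- by apply: mulr_ge0; [exact: powR_ge0|do 2!apply: exprn_ge0].
rewrite [_ ^+ k ^+ D.+2]exprSr -exprM [leRHS]mulrCA ler_wpM2l ?exprn_ge0 //.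
have -> : - ((1 - eps / 2) * k%:R) = eps * k%:R / 2 - k%:R by ring.
rewrite powRD ?pnatr_eq0 ?implybT // powRN powR_mulrn // mulfVK ?gt_eqF //.
(* Both summands are at most [2 ^ e], by [d_lt] and [tD]. As [1 <= e], the exponent [1 + e] is at
   most [5 e / 2 = eps * k / 2]. *)
apply: (@le_trans _ _ (2 `^ (1 + e))).
  rewrite powRD ?pnatr_eq0 ?implybT // powRr1 // [leRHS]mulr_natl [leRHS]mulr2n.
  apply: lerD; first exact: ltW.
  by rewrite ler_powR // ler1n.
by rewrite ler_powR ?ler1n //; move: e1; rewrite /e; lra.
Qed.
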